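(* Let $A$ be an abstract algebra of type $\tau$. The profinite completion $\widehat{A}$ is homeomorphic as a topological algebra to the extended Stone dual of $\mathrm{Rec}(A)$, the Boolean algebra of recognizable subsets of $A$ equipped with its residuation operations. That is, there is a homeomorphism from $\widehat{A}$ to the Stone space of $\mathrm{Rec}(A)$ which, for each operation symbol $f\in\tau$ of arity $n\geq 1$, carries the graph of the operation $f$ on $\widehat{A}$ to the relation $R_f$ dual to the residuation operations for $f$ on $\mathrm{Rec}(A)$.
   Context: The profinite completion $\widehat A$ of $A$ is the inverse limit, in topological algebras of type $\tau$, of the finite discrete algebras $A/\theta$, where $\theta$ ranges over the congruences of $A$ of finite index (ordered by reverse inclusion), with the canonical maps $A/\theta\to A/\psi$ for $\theta\subseteq\psi$. A subset $L\subseteq A$ is recognizable if there are a finite algebra $F$ of type $\tau$, a homomorphism $\varphi:A\to F$ and $P\subseteq F$ with $L=\varphi^{-1}(P)$. $\mathrm{Rec}(A)$ is the Boolean algebra of recognizable subsets of $A$. It is closed under the residuation operations of $\mathcal P(A)$: for each $n$-ary $f\in\tau$ and $1\leq i\leq n$, $$f_i^\sharp(L_1,\ldots,L_{i-1},L_{i+1},\ldots,L_n,L)=\{a\in A\mid \forall a_j\in L_j\ (j\neq i):\ f(a_1,\ldots,a_{i-1},a,a_{i+1},\ldots,a_n)\in L\}.$$ The extended Stone dual of $B=\mathrm{Rec}(A)$ is its Stone space $X_B$ (points $x$ are prime filters $F_x$ of $B$, topology generated by the sets $\{x\mid L\in F_x\}$, $L\in B$) with, for each $f$ of arity $n\geq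 1$, the relation $R_f\subseteq X_B^n\times X_B$ where $(x_1,\ldots,x_n,z)\in R_f$ iff for all $K_j\in F_{x_j}$ ($j\neq i$) and all $L\notin F_z$, $f_i^\sharp(K_1,\ldots,K_{i-1},K_{i+1},\ldots,K_n,L)\notin F_{x_i}$ (this is independent of the choice of $i$). *)

(* Defs.v *)
From HB Require Import structures.
From mathcomp Require Import all_boot all_order.
From mathcomp Require Import all_classical topology.

Set Implicit Arguments.
Unset Strict Implicit.
Unset Printing Implicit Defensive.

Import Order.TTheory.
Local Open Scope classical_set_scope.
Local Open Scope quotient_scope.

Record signature := Signature {
  symbol :> Type;
  arity : symbol -> nat }.

(* The carrier is a choiceType, as for all MathComp algebraic structures: in  *)
(* the classical setting of MathComp-Analysis this is no restriction, see     *)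
(* boolp.gen_choiceMixin. The carrier may be empty.                           *)
Record algebra (tau : signature) := Algebra {
  carrier :> choiceType;
  op : forall f : tau, ('I_(arity f) -> carrier) -> carrier }.
Arguments op {tau a} f v : rename.

Definition is_hom (tau : signature) (A B : algebra tau) (phi : A -> B) :=
  forall (f : tau) (v : 'I_(arity f) -> A), phi (op f v) = op f (phi \o v).

Section Congruences.
Variables (tau : signature) (A : algebra tau).

Record congruence := Congruence {
  cong_rel :> equiv_rel A;
  cong_op : forall (f : tau) (v w : 'I_(arity f) -> A),
    (forall i, cong_rel (v i) (w i)) -> cong_rel (op f v) (op f w) }.

Definition quotient_algebra (theta : congruence) : algebra tau :=
  @Algebra tau {eq_quot theta}
    (fun f v => \pi_({eq_quot theta}) (op f (fun i => repr (v i)))).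

Definition quotient_map (theta : congruence) (a : A) : quotient_algebra theta :=
  \pi_({eq_quot theta}) a.

Lemma quotient_mapP (theta : congruence) (a b : A) :
  quotient_map theta a = quotient_map theta b <-> theta a b.
Proof. by split=> [/eqmodP|ab] //; apply/eqmodP. Qed.

Lemma quotient_map_hom (theta : congruence) : is_hom (quotient_map theta).
Proof.
move=> f v; apply/quotient_mapP; apply: cong_op => i /=.
by apply/quotient_mapP; rewrite /quotient_map reprK.
Qed.

Record fin_congruence := FinCongruence {
  fin_cong :> congruence;
  fin_congP : finite_set [set: quotient_algebra fin_cong] }.

Definition cong_le (theta psi : congruence) :=
  forall a b : A, theta a b -> psi a b.

(* Only meaningful when cong_le theta psi, see transitionE. *)
Definition transition (theta psi : congruence) (c : quotient_algebra theta) :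
  quotient_algebra psi := quotient_map psi (repr (c : {eq_quot theta})).

Lemma transitionE (theta psi : congruence) (a : A) : cong_le theta psi ->
  transition psi (quotient_map theta a) = quotient_map psi a.
Proof.
move=> le; apply/quotient_mapP; apply: le; apply/quotient_mapP.
by rewrite /quotient_map reprK.
Qed.

Lemma transition_hom (theta psi : congruence) : cong_le theta psi ->
  is_hom (@transition theta psi).
Proof.
move=> le f v; rewrite [op f v](_ : _ =
  quotient_map theta (op f (fun i => repr (v i : {eq_quot theta})))) //.
by rewrite transitionE // quotient_map_hom.
Qed.

Definition compatible_families :
    set (prod_topology (fun theta : fin_congruence =>
      discrete_topology (quotient_algebra theta))) :=
  [set x | forall theta psi : fin_congruence, cong_le theta psi ->
    transition psi (x theta) = x psi].

(* The limit carries the topology induced by the product of the discrete      *)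
(* spaces A/theta, and the componentwise operations.                          *)
Definition profinite_completion : topologicalType :=
  set_type compatible_families.

Definition component (theta : fin_congruence) (x : profinite_completion) :
  quotient_algebra theta := (set_val x : prod_topology _) theta.

Lemma profinite_op_subproof (f : tau)
    (v : 'I_(arity f) -> profinite_completion) :
  (fun theta => op f (fun i => component theta (v i))) \in compatible_families.
Proof.
apply/mem_set => theta psi le /=; rewrite transition_hom //; apply: congr1.
by apply/funext => i /=; have /set_mem := valP (v i); exact.
Qed.

Definition profinite_op (f : tau) (v : 'I_(arity f) -> profinite_completion) :
  profinite_completion :=
  exist (fun x => x \in compatible_families) _ (profinite_op_subproof v).

Lemma component_continuous (theta : fin_congruence) :
  continuous (component theta : _ -> discrete_topology _).
Proof.
move=> x U nU; apply: (@initial_continuous _ _ set_val x (@^~ theta @^-1` U)).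
have /cvg_sup/(_ theta) : nbhs (set_val x) --> set_val x by exact: cvg_id.
by apply; exact: (@initial_continuous _ _ (@^~ theta) (set_val x) U).
Qed.

(* The completion is a topological algebra. *)
Lemma profinite_op_continuous (f : tau) :
  continuous (profinite_op (f := f) : prod_topology _ -> _).
Proof.
apply: continuous_comp_initial => v.
apply/cvg_sup; first by apply: fmap_filter; exact: nbhs_filter.
move=> theta U [_ [[V _ <-] Vv] VU].
have nD i : \forall w \near (v : prod_topology _),
    component theta (w i) = component theta (v i).
  have /cvg_sup/(_ i) : nbhs (v : prod_topology _) --> (v : prod_topology _).
    exact: cvg_id.
  apply; apply: (@initial_continuous _ _ (@^~ i) v
    (component theta @^-1` [set component theta (v i)])).
  by apply: component_continuous; exact: discrete_set1.
have := filter_forall (nbhs_filter (v : prod_topology _)) nD.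
apply: (@filterS _ (nbhs (v : prod_topology _)) _) => w Dw.
apply: VU; move: Vv; suff e : op f (fun i => component theta (w i)) =
    op f (fun i => component theta (v i)).
  by rewrite /preimage /= -[X in V X -> _]e.
by congr (op f _); apply/funext.
Qed.

End Congruences.
Arguments profinite_op {tau A} f v.

Section Recognizable.
Variables (tau : signature).

Definition recognizable (A : algebra tau) : set (set A) :=
  [set L | exists (F : algebra tau) (phi : A -> F) (P : set F),
    [/\ finite_set [set: F], is_hom phi & L = phi @^-1` P]].

Definition prod_algebra (F G : algebra tau) : algebra tau :=
  @Algebra tau (F * G)%type
    (fun f v => (op f (fun i => (v i).1), op f (fun i => (v i).2))).

Definition unit_algebra : algebra tau := @Algebra tau unit (fun _ _ => tt).

Variable A : algebra tau.
Implicit Types K L : set A.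

Lemma recognizableI K L :
  recognizable K -> recognizable L -> recognizable (K `&` L).
Proof.
move=> [F [phi [P [finF hphi ->]]]] [G [psi [Q [finG hpsi ->]]]].
exists (prod_algebra F G), (fun a => (phi a, psi a)), (P `*` Q); split=> //.
- by rewrite -setXTT; exact: finite_setX.
- by move=> f v; rewrite hphi hpsi.
Qed.

Lemma recognizableC L : recognizable L -> recognizable (~` L).
Proof.
by move=> [F [phi [P [finF hphi ->]]]]; exists F, phi, (~` P); split.
Qed.

Lemma recognizableU K L :
  recognizable K -> recognizable L -> recognizable (K `|` L).
Proof.
move=> rK rL; rewrite -[K `|` L]setCK setCU.
by apply/recognizableC/recognizableI; apply: recognizableC.
Qed.

Lemma recognizableT : recognizable [set: A].
Proof.
exists unit_algebra, (fun=> tt), setT; split=> //.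
apply: (sub_finite_set (B := [set tt])); last exact: finite_set1.
by case.
Qed.

Lemma recognizable0 : recognizable (set0 : set A).
Proof. by rewrite -setCT; exact/recognizableC/recognizableT. Qed.

(* The i-th residual of f, i.e. f_i^#(K_1, .., K_(i-1), K_(i+1), .., K_n, L); *)
(* the entry K i of the family K is not used.                                 *)
Definition residual (f : tau) (i : 'I_(arity f)) (K : 'I_(arity f) -> set A)
    (L : set A) : set A :=
  [set a | forall v : 'I_(arity f) -> A,
    v i = a -> (forall j, j != i -> K j (v j)) -> L (op f v)].

Lemma recognizable_residual (f : tau) (i : 'I_(arity f))
    (K : 'I_(arity f) -> set A) L :
  recognizable L -> recognizable (residual i K L).
Proof.
move=> [F [phi [P [finF hphi ->]]]].
exists F, phi, (phi @` residual i K (phi @^-1` P)); split=> //.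
apply/seteqP; split=> [a ra|b [a ra /= eab] v vi vK]; first by exists a.
pose w j := if j == i then a else v j.
have : (phi @^-1` P) (op f w).
  apply: ra => [|j ji]; first by rewrite /w eqxx.
  by rewrite /w (negbTE ji); exact: vK.
rewrite /preimage /= !hphi; congr (P (op f _)); apply/funext => j /=.
by rewrite /w; case: eqVneq => // ->; rewrite vi.
Qed.

Definition Rec : Type := {L : set A | L \in @recognizable A}.

HB.instance Definition _ := SubChoice.on Rec.

End Recognizable.

Section RecBooleanAlgebra.
Variables (tau : signature) (A : algebra tau).

Let memI : Order.ClosedPredicates.meet_closed (mem (@recognizable tau A)).
Proof.
by move=> K L /set_mem rK /set_mem rL; apply/mem_set; exact: recognizableI.
Qed.

Let memU : Order.ClosedPredicates.join_closed (mem (@recognizable tau A)).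
Proof.
by move=> K L /set_mem rK /set_mem rL; apply/mem_set; exact: recognizableU.
Qed.

Let mem0 : (\bot : set A)%O \in mem (@recognizable tau A).
Proof. by apply/mem_set; exact: recognizable0. Qed.

Let mem1 : (\top : set A)%O \in mem (@recognizable tau A).
Proof. by apply/mem_set; exact: recognizableT. Qed.

HB.instance Definition _ := Order.SubChoice_isTBSubLattice.Build
  set_display (set A) (mem (@recognizable tau A)) set_display (Rec A)
  memI memU mem0 mem1.

Let Rec_meetUl : @left_distributive (Rec A) (Rec A) Order.meet Order.join.
Proof. by move=> x y z; apply: val_inj => /=; exact: meetUl. Qed.

HB.instance Definition _ := Order.Lattice_Meet_isDistrLattice.Build
  set_display (Rec A) Rec_meetUl.

Let Rec_compl (L : Rec A) : Rec A :=
  exist (fun M => M \in @recognizable tau A) _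
    (mem_set (recognizableC (set_mem (valP L)))).

Let Rec_joinxC (L : Rec A) : (L `|` Rec_compl L)%O = \top%O.
Proof. by apply: val_inj; exact: setUv. Qed.

Let Rec_meetxC (L : Rec A) : (L `&` Rec_compl L)%O = \bot%O.
Proof. by apply: val_inj; exact: setICr. Qed.

HB.instance Definition _ := Order.TBDistrLattice_hasComplement.Build
  set_display (Rec A) Rec_joinxC Rec_meetxC.

Definition Rec_residual (f : tau) (i : 'I_(arity f)) (K : 'I_(arity f) -> Rec A)
    (L : Rec A) : Rec A :=
  exist (fun M => M \in @recognizable tau A) _
    (mem_set (recognizable_residual i (val \o K) (set_mem (valP L)))).

End RecBooleanAlgebra.
Arguments Rec_residual {tau A} f i K L.

Section StoneDual.
Variables (d : Order.disp_t) (B : ctbDistrLatticeType d).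

Definition prime_filter (F : set B) :=
  [/\ F \top%O, ~ F \bot%O,
      forall a b, (a <= b)%O -> F a -> F b,
      forall a b, F a -> F b -> F (a `&` b)%O &
      forall a b, F (a `|` b)%O -> F a \/ F b].

Record stone_space := StonePoint {
  stone_filter : set B;
  stone_filter_prime : prime_filter stone_filter }.

HB.instance Definition _ := gen_eqMixin stone_space.
HB.instance Definition _ := gen_choiceMixin stone_space.

Definition stone_basic (b : B) : set stone_space := [set x | stone_filter x b].

HB.instance Definition _ := isSubBaseTopological.Build stone_space
  (range stone_basic) id.

(* The relation dual to the residuation operations res i, computed from the   *)
(* i-th one; res i K L is meant not to depend on K i.                         *)
Definition dual_relation (n : nat) (res : 'I_n -> ('I_n -> B) -> B -> B)
    (i : 'I_n) : set (('I_n -> stone_space) * stone_space) :=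
  [set xz | forall (K : 'I_n -> B) (L : B),
    (forall j, j != i -> stone_filter (xz.1 j) (K j)) ->
    ~ stone_filter xz.2 L -> ~ stone_filter (xz.1 i) (res i K L)].

End StoneDual.
Arguments stone_space {d} B.
Arguments dual_relation {d B n} res i.

Definition homeomorphism (X Y : topologicalType) (h : X -> Y) :=
  continuous h /\ exists g : Y -> X,
    [/\ cancel h g, cancel g h & continuous g].

(* Main.v *)
Require Import Defs.
From mathcomp Require Import all_boot all_order.
From mathcomp Require Import all_classical topology.
Local Open Scope classical_set_scope.

Set Implicit Arguments.
Unset Strict Implicit.
Unset Printing Implicit Defensive.

Import Order.TTheory.

(** A point [x] of the profinite completion chooses, coherently, one class of
each finite-index congruence [theta]. A recognizable set [L] is a union of
classes of (is saturated by) some finite-index [theta], namely the kernel of a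
homomorphism recognizing it. So it makes sense to say that [x] lies in [L]: the
class of [theta] chosen by [x] is one of those making up [L]. This does not
depend on [theta] ([point_filterE]), because two finite-index congruences have
a common finite-index refinement. The recognizable sets containing [x] form a
prime filter, which defines the map [to_stone].

Conversely, the classes of [theta] are recognizable, pairwise disjoint, and
finitely many of them cover [A]; a prime filter therefore contains exactly one
of them, and these choices are coherent ([to_stone_surj]). Under this
correspondence the set of points whose [theta]-component is [c] is the basic
clopen set of the class [c] ([to_stone_class]), whence both continuity claims.

For the operations ([to_stone_op]), suppose [f x = z]. Finitely many
recognizable sets are involved in an instance of the dual relation, so one
[theta] saturates them all, and replacing [x] and [z] by representatives modulo
[theta] turns the instance into the definition of the residual in [A]. Suppose
now that [f x] and [z] differ, say modulo [theta]. Let [K j] be the class of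
[x j], and [L] the class of [f x]. As [theta] is a congruence, the residual of
[L] by the [K j] contains the class of [x i], hence belongs to the filter of
[x i], whereas [L] does not belong to that of [z]: the dual relation fails. *)

(** * Finite-index congruences and recognizable sets *)

Section FiniteCongruences.
Variables (tau : signature) (A : algebra tau).
Implicit Types (theta psi : fin_congruence A) (x : profinite_completion A).

Section Kernel.
Variables (F : algebra tau) (phi : A -> F).
Hypotheses (finF : finite_set [set: F]) (hphi : is_hom phi).

Let kernel_rel : rel A := fun a b => phi a == phi b.

Let kernel_rel_trans : transitive kernel_rel.
Proof. by move=> b a c /eqP ab /eqP bc; rewrite /kernel_rel ab bc. Qed.

Let kernel_equiv : equiv_rel A :=
  EquivRel kernel_rel (fun a => eqxx (phi a))
    (fun a b => eq_sym (phi a) (phi b)) kernel_rel_trans.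

Let kernel_op (f : tau) (v w : 'I_(arity f) -> A) :
  (forall i, kernel_equiv (v i) (w i)) -> kernel_equiv (op f v) (op f w).
Proof.
move=> vw; apply/eqP; rewrite !hphi; congr (op f _).
by apply/funext => i; exact/eqP/vw.
Qed.

Let kernel_congruence : congruence A := Congruence kernel_op.

Let kernel_finite : finite_set [set: quotient_algebra kernel_congruence].
Proof.
pose mu (c : quotient_algebra kernel_congruence) : F :=
  phi (generic_quotient.repr (c : {eq_quot kernel_congruence}%qT)).
rewrite -(preimage_setT mu); apply: finite_preimage => // c d _ _ cd.
rewrite -[c]generic_quotient.reprK -[d]generic_quotient.reprK.
by apply/quotient_mapP/eqP.
Qed.

Definition kernel : fin_congruence A := FinCongruence kernel_finite.

Lemma kernelP a b : kernel a b <-> phi a = phi b.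
Proof. by split=> /eqP. Qed.

End Kernel.

(** The kernel of the pairing of the two quotient maps is the intersection of
the two congruences. *)
Lemma common_refinement theta psi : exists chi : fin_congruence A,
  cong_le chi theta /\ cong_le chi psi.
Proof.
pose G := prod_algebra (quotient_algebra theta) (quotient_algebra psi).
pose g a : G := (quotient_map theta a, quotient_map psi a).
have finG : finite_set [set: G].
  by rewrite -setXTT; apply: finite_setX; exact: fin_congP.
have hg : is_hom g by move=> f v; rewrite /g !quotient_map_hom.
exists (kernel finG hg).
by split=> a b /kernelP [] /quotient_mapP + /quotient_mapP.
Qed.

(** The total relation, as the kernel of the map to the one-element algebra. *)
Lemma exists_fin_congruence : exists theta, forall a b, theta a b.
Proof.
have fin1 : finite_set [set: unit_algebra tau].
  by apply: (sub_finite_set (B := [set tt])) => [[]|]; last exact: finite_set1.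
have h1 : is_hom (fun _ : A => tt : unit_algebra tau) by [].
by exists (kernel fin1 h1) => a b; exact/kernelP.
Qed.

Definition saturates (theta : congruence A) (L : set A) :=
  forall a b, theta a b -> L a -> L b.

Lemma saturates_le (theta psi : congruence A) (L : set A) :
  cong_le theta psi -> saturates psi L -> saturates theta L.
Proof. by move=> le satL a b /le; exact: satL. Qed.

Lemma recognizable_saturated (L : set A) :
  recognizable L -> exists theta, saturates theta L.
Proof.
move=> [F [phi [P [finF hphi ->]]]]; exists (kernel finF hphi) => a b.
by move=> /kernelP; rewrite /preimage /= => ->.
Qed.

(** This is what allows an argument involving finitely many recognizable sets
to be carried out in a single finite quotient of [A]. *)
Lemma common_saturation (s : seq (Rec A)) :
  exists theta, forall L, L \in s -> saturates theta (\val L).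
Proof.
elim: s => [|L s [theta thetas]].
  by have [theta _] := exists_fin_congruence; exists theta.
have [psi psiL] := recognizable_saturated (set_mem (valP L)).
have [chi [le_theta le_psi]] := common_refinement theta psi.
exists chi => M; rewrite inE => /orP[/eqP->|/thetas satM].
  exact: saturates_le psiL.
exact: saturates_le satM.
Qed.

Lemma common_saturation2 (K L : Rec A) :
  exists theta, saturates theta (\val K) /\ saturates theta (\val L).
Proof.
have [theta sat] := common_saturation [:: K; L].
by exists theta; split; apply: sat; rewrite !inE eqxx ?orbT.
Qed.

Definition rep theta x : A :=
  generic_quotient.repr (component theta x : {eq_quot theta}%qT).

Lemma quotient_rep theta x :
  quotient_map theta (rep theta x) = component theta x.
Proof. exact: generic_quotient.reprK. Qed.

Lemma rep_le theta psi x : cong_le theta psi -> psi (rep theta x) (rep psi x).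
Proof.
move=> le; apply/quotient_mapP; rewrite quotient_rep.
by have /set_mem/(_ theta psi le) := valP x.
Qed.

Lemma profinite_eq x y :
  (forall theta, component theta x = component theta y) -> x = y.
Proof. by move=> xy; apply: val_inj; apply/functional_extensionality_dep. Qed.

Lemma recognizable_class theta (c : quotient_algebra theta) :
  recognizable (quotient_map theta @^-1` [set c]).
Proof.
exists (quotient_algebra theta), (quotient_map theta), [set c].
by split=> //; [exact: fin_congP|exact: quotient_map_hom].
Qed.

Definition class theta (c : quotient_algebra theta) : Rec A :=
  exist (fun M => M \in @recognizable tau A) _ (mem_set (recognizable_class c)).

Lemma saturates_class theta (c : quotient_algebra theta) :
  saturates theta (\val (class c)).
Proof. by move=> a b /quotient_mapP ab /= <-; exact/esym. Qed.

Lemma class_le theta (c : quotient_algebra theta) (L : Rec A) :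
  (forall a, quotient_map theta a = c -> \val L a) -> (class c <= L)%O.
Proof.
by move=> cL; rewrite -Order.le_val; apply/subsetPset => a; exact: cL.
Qed.

(** This is where finite index enters: the join of all the classes is a finite
join, through which a prime filter can be split. *)
Lemma classes_cover theta : exists s : seq (quotient_algebra theta),
  (\join_(c <- s) class c)%O = \top%O.
Proof.
have /finite_seqP[s es] := fin_congP theta; exists s.
apply/eqP; rewrite -le1x -Order.le_val; apply/subsetPset => a _.
have sa : quotient_map theta a \in s.
  by have : [set` s] (quotient_map theta a) by rewrite -es.
have : (class (quotient_map theta a) <= \join_(c <- s) class c)%O.
  exact: joins_sup_seq.
by rewrite -Order.le_val => /subsetPset; apply.
Qed.

End FiniteCongruences.

(** * Stone spaces *)

Section StoneSpace.
Variables (d : Order.disp_t) (B : ctbDistrLatticeType d).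
Implicit Types y : stone_space B.

Lemma stone_eq y y' :
  (forall b, stone_filter y b <-> stone_filter y' b) -> y = y'.
Proof.
case: y y' => [F pF] [G pG] /= FG.
have eFG : F = G by apply/seteqP; split=> b /FG.
by move: pG; rewrite -eFG => pG; congr StonePoint; exact: Prop_irrelevance.
Qed.

Lemma stone_filter_le y b b' :
  (b <= b')%O -> stone_filter y b -> stone_filter y b'.
Proof. by case: (stone_filter_prime y) => _ _ + _ _; exact. Qed.

Lemma stone_filter_disjoint y b b' :
  stone_filter y b -> stone_filter y b' -> (b `&` b')%O <> \bot%O.
Proof.
case: (stone_filter_prime y) => _ n0 _ FI _ yb yb' e.
by apply: n0; rewrite -e; exact: FI.
Qed.

Lemma stone_filter_join (I : eqType) (s : seq I) (b : I -> B) y :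
  stone_filter y (\join_(i <- s) b i)%O -> exists i, stone_filter y (b i).
Proof.
case: (stone_filter_prime y) => _ n0 _ _ FU.
elim: s => [|i s IHs]; first by rewrite big_nil.
by rewrite big_cons => /FU[yi|/IHs //]; exists i.
Qed.

Lemma open_stone_basic (b : B) : open (stone_basic b).
Proof.
exists [set stone_basic b]; last by rewrite bigcup_set1.
by move=> _ ->; apply: (finI_from1 id); exists b.
Qed.

Lemma continuous_stone (X : topologicalType) (h : X -> stone_space B) :
  (forall b, open (h @^-1` stone_basic b)) -> continuous h.
Proof.
move=> oh x U; rewrite /= nbhsE => -[V [oV Vx] VU].
apply: (@filterS _ _ _ (h @^-1` V)) => [z /VU //|].
case: oV Vx {VU} => D sD <- [W DW Wx].
apply: (@filterS _ _ _ (h @^-1` W)) => [z Wz|]; first by exists W.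
have [E sE eE] := sD _ DW; move: Wx; rewrite -eE => Wx.
rewrite preimage_bigcap; apply: filter_bigI => C CE.
have /set_mem[b _ eb] := sE _ CE.
rewrite -eb; apply: open_nbhs_nbhs; split; first exact: oh.
by rewrite eb; exact: Wx.
Qed.

End StoneSpace.

(** * The homeomorphism *)

Section Homeomorphism.
Variables (tau : signature) (A : algebra tau).
Implicit Types (theta : fin_congruence A) (x : profinite_completion A).
Implicit Types (y : stone_space (Rec A)) (L : Rec A).

(** The saturating [theta] is quantified rather than chosen from [L], so that
one [theta] can serve for several sets at once. *)
Definition point_filter x : set (Rec A) :=
  [set L | exists theta, saturates theta (\val L) /\ \val L (rep theta x)].

(** Two saturating congruences are compared through a common refinement [chi]:
the representatives that they give are both related to the one given by
[chi]. *)
Lemma point_filterE theta x L : saturates theta (\val L) ->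
  point_filter x L <-> \val L (rep theta x).
Proof.
move=> satL; split=> [[psi [psiL Lx]]|Lx]; last by exists theta.
have [chi [le_theta le_psi]] := common_refinement theta psi.
apply: satL (rep_le x le_theta) _.
apply: psiL Lx; rewrite generic_quotient.equiv_sym; exact: rep_le.
Qed.

Lemma point_filter_prime x : prime_filter (point_filter x).
Proof.
have [theta0 _] := exists_fin_congruence A.
split.
- by exists theta0.
- by case=> theta [].
- move=> K L KL.
  have [theta [satK satL]] := common_saturation2 K L.
  move=> /(point_filterE _ satK) Kx; apply/(point_filterE _ satL).
  by move: KL; rewrite -Order.le_val => /subsetPset; apply.
- move=> K L.
  have [theta [satK satL]] := common_saturation2 K L.
  move=> /(point_filterE _ satK) Kx /(point_filterE _ satL) Lx.
  by exists theta; split=> // a b ab [/(satK _ _ ab) ? /(satL _ _ ab)].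
- move=> K L.
  have [theta [satK satL]] := common_saturation2 K L.
  have satKL : saturates theta (\val (K `|` L)%O).
    by move=> a b ab [/(satK _ _ ab)|/(satL _ _ ab)]; [left|right].
  move=> /(point_filterE _ satKL)[Kx|Lx].
    by left; exact/(point_filterE _ satK).
  by right; exact/(point_filterE _ satL).
Qed.

Definition to_stone x : stone_space (Rec A) :=
  StonePoint (point_filter_prime x).

(** The basic open sets of the classes pull back to the fibres of the
components. This is the link between the two topologies, and it also
determines a point from its filter. *)
Lemma to_stone_class theta x (c : quotient_algebra theta) :
  stone_filter (to_stone x) (class c) <-> component theta x = c.
Proof.
by rewrite -quotient_rep; exact: point_filterE (saturates_class (c := c)).
Qed.

Lemma to_stone_inj : injective to_stone.
Proof.
move=> x x' xx'; apply: profinite_eq => theta.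
by apply/esym/to_stone_class; rewrite -xx'; exact/to_stone_class.
Qed.

Lemma stone_class_ex y theta :
  exists c : quotient_algebra theta, stone_filter y (class c).
Proof.
have [s s1] := classes_cover theta; apply: (@stone_filter_join _ _ _ s).
by rewrite s1; case: (stone_filter_prime y).
Qed.

(** Two members of a prime filter cannot be disjoint. This makes the class in
[y] unique, and a saturated [L] in [y] must contain that class. *)
Lemma stone_class_sub y theta (c : quotient_algebra theta) L :
  stone_filter y (class c) -> stone_filter y L ->
  exists2 a, quotient_map theta a = c & \val L a.
Proof.
move=> yc yL; apply: contrapT => nL; apply: (stone_filter_disjoint yc yL).
apply: val_inj; rewrite -subset0 => a [/= ac La].
by apply: nL; exists a.
Qed.

(** If [theta] refines [psi], the chosen classes of [theta] and of [psi] have a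
common element, so the first is mapped to the second. *)
Lemma stone_family_compatible y (c : forall theta, quotient_algebra theta) :
  (forall theta, stone_filter y (class (c theta))) ->
  c \in @compatible_families tau A.
Proof.
move=> yc; apply/mem_set => theta psi le /=.
by have [a <- <-] := stone_class_sub (yc theta) (yc psi); rewrite transitionE.
Qed.

Lemma to_stone_surj y : exists x, to_stone x = y.
Proof.
pose c theta := projT1 (cid (stone_class_ex y theta)).
have yc theta : stone_filter y (class (c theta)).
  exact: projT2 (cid (stone_class_ex y theta)).
pose x : profinite_completion A :=
  exist (fun x : prod_topology _ => x \in @compatible_families tau A) c
    (stone_family_compatible yc).
exists x; apply: stone_eq => L.
have [theta satL] := recognizable_saturated (set_mem (valP L)).
have xc : quotient_map theta (rep theta x) = c theta by rewrite quotient_rep.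
split=> [/(point_filterE _ satL) Lx|yL].
  apply: stone_filter_le (yc theta); apply: class_le => a; rewrite -xc.
  by move=> /esym/quotient_mapP /satL; exact.
apply/(point_filterE _ satL).
have [a] := stone_class_sub (yc theta) yL; rewrite -xc.
by move=> /quotient_mapP /satL; exact.
Qed.

Lemma to_stone_continuous : continuous to_stone.
Proof.
apply: continuous_stone => L.
have [theta satL] := recognizable_saturated (set_mem (valP L)).
rewrite openE => x Lx.
apply: (@filterS _ (nbhs x) _
  (component theta @^-1` [set component theta x])) => [z /= zx|].
  apply/(point_filterE _ satL); move/(point_filterE _ satL): Lx.
  by apply: satL; apply/quotient_mapP; rewrite !quotient_rep.
by apply: component_continuous; exact: discrete_set1.
Qed.

Lemma to_stone_inv_continuous
    (g : stone_space (Rec A) -> profinite_completion A) :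
  cancel g to_stone -> continuous g.
Proof.
move=> gK; apply: continuous_comp_initial => y.
apply/cvg_sup; first by apply: fmap_filter; exact: nbhs_filter.
move=> theta U [_ [[V _ <-] Vy] VU].
apply: (@filterS _ (nbhs y) _
  (stone_basic (class (component theta (g y))))) => [z|].
  rewrite /stone_basic /= -{1}[z]gK => /to_stone_class gz.
  by apply: VU; move: Vy; rewrite /preimage /= -/(component theta (g y)) -gz.
apply: open_nbhs_nbhs; split; first exact: open_stone_basic.
by rewrite /stone_basic /= -{1}[y]gK; exact/to_stone_class.
Qed.

(** The reason is that [A] and the completion have the same finite quotients
[A / theta]: representatives modulo one [theta] stand in for the points, and
the classes of one [theta] are enough to detect that [f x] is not [z]. *)
Lemma to_stone_op (f : tau) (i : 'I_(arity f))
    (x : 'I_(arity f) -> profinite_completion A) (z : profinite_completion A) :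
  profinite_op f x = z <->
    dual_relation (Rec_residual f) i (to_stone \o x, to_stone z).
Proof.
split=> [<- K L Kx nLz Rx|dual].
  pose R := Rec_residual f i K L.
  have [theta sat] :=
    common_saturation [:: L, R & [seq K j | j <- enum 'I_(arity f)]].
  have satL : saturates theta (\val L) by apply: sat; rewrite !inE eqxx.
  have satR : saturates theta (\val R) by apply: sat; rewrite !inE eqxx orbT.
  have satK j : saturates theta (\val (K j)).
    by apply: sat; rewrite !inE map_f ?orbT // mem_enum.
  apply: nLz; apply/(point_filterE _ satL).
  have /(point_filterE _ satR) Ri := Rx.
  have := Ri (fun j => rep theta (x j)) erefl.
  have Kj j : j != i -> \val (K j) (rep theta (x j)).
    by move=> /Kx/(point_filterE _ (satK j)).
  move=> /(_ Kj); apply: satL; apply/quotient_mapP; rewrite quotient_rep.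
  rewrite quotient_map_hom; congr (op f _); apply/funext => j /=.
  exact: quotient_rep.
(* The dual relation is tested on the classes of the x j and of f x modulo a
   congruence theta separating f x from z. *)
apply: profinite_eq => theta; apply: contrapT => ne.
pose c := op f (fun j => component theta (x j)).
apply: (dual (fun j => class (component theta (x j))) (class c)) => /=.
- by move=> j _; exact/to_stone_class.
- by move=> /to_stone_class/esym.
have : stone_filter (to_stone (x i)) (class (component theta (x i))).
  exact/to_stone_class.
apply: stone_filter_le; apply: class_le => a ax v vi vj /=.
suff e : quotient_map theta \o v = (fun j => component theta (x j)).
  by rewrite quotient_map_hom e.
apply/funext => j /=; have [->|/vj //] := eqVneq j i.
by rewrite vi.
Qed.

End Homeomorphism.

Theorem theorem4p5 (tau : signature) (A : algebra tau) :
  exists h : profinite_completion A -> stone_space (Rec A),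
    homeomorphism h /\
    forall (f : tau) (i : 'I_(arity f)),
      [set (h \o xz.1, h xz.2) | xz in
        [set xz : ('I_(arity f) -> profinite_completion A) *
                  profinite_completion A | profinite_op f xz.1 = xz.2]] =
      dual_relation (Rec_residual f) i.
Proof.
have [g gK] := choice (@to_stone_surj tau A).
exists (@to_stone tau A); split.
  split; first exact: to_stone_continuous.
  exists g; split=> // [x|]; first exact/to_stone_inj/gK.
  exact: to_stone_inv_continuous.
move=> f i; apply/seteqP; split=> [_ [[x z] /= xz <-]|[y w] yw].
  exact/to_stone_op.
have ey : @to_stone tau A \o (g \o y) = y by apply/funext => j; exact: gK.
exists (g \o y, g w) => /=; last by rewrite ey gK.
by apply/(to_stone_op i); rewrite ey gK.
Qed.
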